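(* Let $d\ge2$ and let $p_1,\ldots,p_{d+1}\in\mathbb R^d$ be fixed points. Let $\eta_0>0$ be the Elekes–Szabó exponent for $s=d+1$ (as described in the context), and set $\eta=\eta_0/2$. For each $i=1,\ldots,d+1$, let $\mathcal S_i$ be a family of $n$ hyperspheres in $\mathbb R^d$ centred at $p_i$, and suppose that the number of points in $\mathbb R^d$ which lie on one hypersphere from each of the families $\mathcal S_1,\ldots,\mathcal S_{d+1}$ is $\Omega(n^{d-\eta})$; that is, there are a constant $C>0$ and arbitrarily large integers $n$ for each of which there exist such families $\mathcal S_1,\ldots,\mathcal S_{d+1}$ of $n$ hyperspheres each (depending on $n$, with the centres $p_i$ fixed) such that at least $C\,n^{d-\eta}$ points of $\mathbb R^d$ lie on one hypersphere from every family. Then the points $p_1,\ldots,p_{d+1}$ are affinely dependent; equivalently, they lie in a common affine hyperplane.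
   Context: Elekes–Szabó exponent: a theorem of Chernikov, Peterzil and Starchenko states the following. Let $s\ge3$ and let $Q\subset\mathbb R^s$ be a semialgebraic set of description complexity at most $D$ (definable by a Boolean combination of at most $D$ polynomial equalities and inequalities of degree at most $D$), such that the projection of $Q$ to any $s-1$ coordinates is finite-to-one. Then exactly one of the following holds: (1) there exist constants $c=c(s,D)>0$ and $\eta_0=\eta_0(s)>0$ such that for all finite sets $A_i\subset\mathbb R$ with $|A_i|=n$ one has $|Q\cap(A_1\times\cdots\times A_s)|\le c\,n^{s-1-\eta_0}$; (2) there exist nonempty open sets $U_i\subset\mathbb R$, an open set $W\subset\mathbb R$ containing $0$, and analytic bijections $\phi_i\colon U_i\to W$ with analytic inverses such that for all $x_i\in U_i$, $(x_1,\ldots,x_s)\in Q\iff\phi_1(x_1)+\cdots+\phi_s(x_s)=0$. The Elekes–Szabó exponent for $s$ is the exponent $\eta_0=\eta_0(s)$ supplied by this theorem; it depends only on $s$ and not on $Q$, $D$ or $n$. A hypersphere centred at $p$ is a set $\{q\in\mathbb R^d:\|q-p\|=r\}$ with $r>0$, where $\|\cdot\|$ is the Euclidean norm. *)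

(* Defs.v *)
From HB Require Import structures.
From mathcomp Require Import all_boot all_order all_algebra.
From mathcomp Require Import finmap.
From mathcomp Require Import all_classical all_reals all_analysis.
(* The notations of mpoly clash with those of mathcomp-analysis. *)
From mathcomp Require Import -(notations) mpoly.

Set Implicit Arguments.
Unset Strict Implicit.
Unset Printing Implicit Defensive.

Import Order.TTheory GRing.Theory Num.Theory.
Import numFieldNormedType.Exports.

Local Open Scope classical_set_scope.
Local Open Scope ring_scope.

(* The norm `|x| of mathcomp-analysis on 'rV[R]_d is the sup norm, so the
   Euclidean one is defined here. *)
Definition dotv (R : realType) (d : nat) (x y : 'rV[R]_d) : R :=
  \sum_(j < d) x 0 j * y 0 j.

Definition eucl_norm (R : realType) (d : nat) (x : 'rV[R]_d) : R :=
  Num.sqrt (dotv x x).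

Definition is_hypersphere (R : realType) (d : nat) (p : 'rV[R]_d)
    (H : set 'rV[R]_d) : Prop :=
  exists r : R, 0 < r /\ H = [set q | eucl_norm (q - p) = r].

Definition affinely_dependent (R : realType) (d m : nat)
    (p : 'I_m -> 'rV[R]_d) : Prop :=
  exists a : 'I_m -> R,
    [/\ exists i, a i != 0, \sum_i a i = 0 & \sum_i a i *: p i = 0].

Definition in_common_hyperplane (R : realType) (d m : nat)
    (p : 'I_m -> 'rV[R]_d) : Prop :=
  exists (v : 'rV[R]_d) (b : R), v != 0 /\ forall i, dotv v (p i) = b.

(* Conditions of the form f <> 0, f < 0, f <= 0, f >= 0 are Boolean combinations
   of a single one of these two (applied to f or to - f). *)
Inductive poly_cond (R : realType) (s : nat) : Type :=
  | PolyEq0 of mpoly s R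
  | PolyGt0 of mpoly s R.

Definition cond_poly (R : realType) (s : nat) (c : poly_cond R s) :
    mpoly s R :=
  match c with PolyEq0 f => f | PolyGt0 f => f end.

Definition cond_holds (R : realType) (s : nat) (x : 'rV[R]_s)
    (c : poly_cond R s) : bool :=
  match c with
  | PolyEq0 f => meval (fun i => x 0 i) f == 0
  | PolyGt0 f => 0 < meval (fun i => x 0 i) f
  end.

(* The Boolean combination is given by its truth function B; msize is the total
   degree plus one (and msize 0 = 0). *)
Definition semialgebraic (R : realType) (s D : nat) (Q : set 'rV[R]_s) : Prop :=
  exists (k : nat) (c : 'I_k -> poly_cond R s) (B : {ffun 'I_k -> bool} -> bool),
    [/\ (k <= D)%N,
        forall i, (mpoly.msize (cond_poly (c i)) <= D.+1)%N
      & Q = [set x | B [ffun i => cond_holds x (c i)]]].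

(* col' i is the projection that forgets the i-th coordinate. *)
Definition finite_to_one_projections (R : realType) (s : nat)
    (Q : set 'rV[R]_s) : Prop :=
  forall (i : 'I_s) (y : 'rV[R]_s.-1), finite_set (Q `&` [set x | col' i x = y]).

Definition analytic_on (R : realType) (U : set R) (f : R -> R) : Prop :=
  forall x, U x -> exists (r : R) (a : nat -> R), 0 < r /\
    forall h, `|h| < r -> pseries a h @ \oo --> f (x + h).

Definition bianalytic (R : realType) (U W : set R) (phi : R -> R) : Prop :=
  [/\ set_bij U W phi,
      analytic_on U phi
    & exists psi : R -> R,
        (forall x, U x -> psi (phi x) = x) /\ analytic_on W psi].

Definition power_saving (R : realType) (s : nat) (eta0 c : R)
    (Q : set 'rV[R]_s) : Prop :=
  forall (n : nat) (A : 'I_s -> {fset R}), (forall i, #|` A i| = n) ->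
    #|` fset_set (Q `&` [set x | forall i, x 0 i \in A i])|%:R
      <= c * n%:R `^ (s%:R - 1 - eta0).

Definition group_form (R : realType) (s : nat) (Q : set 'rV[R]_s) : Prop :=
  exists (U : 'I_s -> set R) (W : set R) (phi : 'I_s -> R -> R),
    [/\ forall i, open (U i) /\ U i !=set0,
        open W /\ W 0,
        forall i, bianalytic (U i) W (phi i)
      & forall x : 'rV[R]_s, (forall i, U i (x 0 i)) ->
          (Q x <-> \sum_i phi i (x 0 i) = 0)].

(* eta0 is an exponent for which the Elekes-Szabo dichotomy of Chernikov,
   Peterzil and Starchenko holds in s variables; c depends on s and D only. *)
Definition elekes_szabo_exponent (R : realType) (s : nat) (eta0 : R) : Prop :=
  [/\ (3 <= s)%N, 0 < eta0
    & forall D : nat, exists c : R, 0 < c /\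
        forall Q : set 'rV[R]_s,
          semialgebraic D Q -> finite_to_one_projections Q ->
          (power_saving eta0 c Q /\ ~ group_form Q) \/
          (~ power_saving eta0 c Q /\ group_form Q)].

(* Main.v *)
Require Import Defs.
From HB Require Import structures.
From mathcomp Require Import all_boot all_order all_algebra.
From mathcomp Require Import finmap.
From mathcomp Require Import all_classical all_reals all_analysis.
Import Order.TTheory GRing.Theory Num.Theory.
Import numFieldNormedType.Exports.
Local Open Scope classical_set_scope.
Local Open Scope ring_scope.
From mathcomp Require Import ring lra.
From mathcomp Require Import -(notations) mpoly.
Set Implicit Arguments.
Unset Strict Implicit.
Unset Printing Implicit Defensive.

(** Suppose that the centres are affinely independent, so that the matrix of
    the edges [p_j - p_0] is invertible.  By polarization, the squared distances
    [t_i = |x - p_i|^2] determine [x] as an affine function of [t]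
    ([locate]), and the vectors [t] that occur form the quadric [relation],
    the zero set of the single quadratic polynomial [relation_poly].  Each
    variable occurs in this polynomial with a nonzero square coefficient, so the
    projections of the quadric are finite-to-one, and the Elekes-Szabo dichotomy
    applies to it.

    If the power saving holds, take for [A_i] the [n] squared radii of the
    spheres around [p_i]: a point on a sphere of every family gives a point of
    the quadric in the grid, and it is recovered from that point, so there are
    at most [c n^(d - eta0)] such points ([count_le]).  For large [n] this is
    smaller than [C n^(d - eta0/2)] ([powR_dominates]).

    The main point is that the quadric has no group form, that is, no relation
    [sum_i phi_i(|x - p_i|^2) = 0] with [phi_i] analytic and locally invertible
    can hold for all [x] in a nonempty open set ([no_additive_relation]).  Write
    [g_i = phi_i'].  Taking the gradient, [sum_i g_i(t_i) (x - p_i) = 0], so the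
    [g_i(t_i)] are proportional to the barycentric coordinates of [x].  For two
    of these coordinates, [u] and [v], belonging to the centres [p_1] and [p_2],
    this reads [u g_2(t_2) = v g_1(t_1)].  Differentiating along a
    direction tangent to the sphere around [p_2] removes [g_2'] and shows that
    [g_1'/g_1], a function of [t_1] alone, is the rational function [num/den] of
    [u] and [v].  It is therefore constant along directions tangent to the
    sphere around [p_1], which is a polynomial identity in [u] and [v]; it holds
    on an open set, hence for all values of [u] and [v].  But on the line
    [v = 0], which belongs to the polar locus of [num/den] and is not invariant
    under rotations around [p_1], the identity fails ([rot_wronskian_eq0],
    [no_additive_relation]). *)

(** * Power series and analytic functions *)

(** For [|z| < s < |K|], each term of [s^(n+1) - |z|^(n+1) =
    (s - |z|) sum_k s^k |z|^(n-k)] is at least [|z|^n], so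
    [(n+1) |z|^n <= s^(n+1) / (s - |z|)]: the derived series at [z] is dominated
    by the original one at [s]. *)
Lemma is_cvg_pseries_diffs (R : realType) (c : nat -> R) (K z : R) :
  cvgn (pseries c K) -> `|z| < `|K| -> cvgn (pseries (pseries_diffs c) z).
Proof.
move=> cK zK; pose s : R := (`|z| + `|K|) / 2.
have zs : `|z| < s by rewrite /s; lra.
have sK : s < `|K| by rewrite /s; lra.
have s0 : 0 < s by rewrite (le_lt_trans _ zs).
have sz0 : 0 < s - `|z| by rewrite subr_gt0.
have cs : cvgn (pseries (fun i => `|c i|) s).
  by apply: is_cvg_pseries_inside_norm cK _; rewrite gtr0_norm.
apply: normed_cvg.
have cs' : cvgn (series (fun n => `|c n.+1| * s ^+ n.+1)).
  have /cvg_ex[l cl] := cs; apply/cvg_ex; exists (l - `|c 0%N| * s ^+ 0).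
  have -> : series (fun n => `|c n.+1| * s ^+ n.+1) =
      (fun n => pseries (fun i => `|c i|) s n.+1 - `|c 0%N| * s ^+ 0).
    apply/funext => n; rewrite /pseries /series /= big_nat_recl//.
    by rewrite addrAC subrr add0r.
  by apply: cvgB; [rewrite cvg_shiftS|exact: cvg_cst].
have := @is_cvg_seriesZ _ _ (s - `|z|)^-1 cs'.
apply: series_le_cvg => n /=.
- exact: normr_ge0.
- by rewrite mulr_ge0 ?invr_ge0 ?mulr_ge0 ?exprn_ge0 // ltW.
- have H : n.+1%:R * `|z| ^+ n <= (s - `|z|)^-1 * s ^+ n.+1.
    rewrite ler_pdivlMl//.
    apply: (@le_trans _ _ (s ^+ n.+1 - `|z| ^+ n.+1)); last first.
      by rewrite lerBlDr lerDl exprn_ge0.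
    rewrite subrXX ler_wpM2l ?(ltW sz0)// mulr_natl -[X in _ *+ X]card_ord.
    rewrite -sumr_const; apply: ler_sum => i _ /=.
    rewrite -[X in `|z| ^+ X <= _](subnK (ltn_ord i : i <= n)%N).
    by rewrite exprD ler_wpM2r ?exprn_ge0// lerXn2r ?nnegrE ?(ltW s0) ?(ltW zs).
  rewrite /pseries_diffs !normrM normrX normr_nat mulrAC mulrC.
  by apply: le_trans (ler_wpM2l (normr_ge0 (c n.+1)) H) _; rewrite mulrCA.
Qed.

(** The second conclusion makes the lemma iterable: the gradient argument below
    uses three derivatives. *)
Lemma analytic_on_derive (R : realType) (U : set R) (f : R -> R) :
  analytic_on U f ->
  (forall x, U x -> is_derive x 1 f (derive1 f x)) /\ analytic_on U (derive1 f).
Proof.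
have key x (r : R) (a : nat -> R) : 0 < r ->
    (forall h, `|h| < r -> pseries a h @ \oo --> f (x + h)) ->
    forall h, `|h| < r ->
      is_derive (x + h) 1 f (limn (pseries (pseries_diffs a) h)) /\
      cvgn (pseries (pseries_diffs a) h).
  move=> r0 af h hr.
  (* [pseries_snd_diffs] asks for the convergence of the series and of its first
     two derived series at one point beyond [h]: each derivation moves the
     point of convergence one step, from [K 3] to [K 1]. *)
  pose K k : R := `|h| + (r - `|h|) * k / 4.
  have hK j k : 0 < j -> j < k -> k < 4 ->
      [/\ `|K j| < `|K k|, `|h| < `|K j| & `|K k| < r].
    have ? := normr_ge0 h; move=> j0 jk k4.
    have [Kj Kk] : `|K j| = K j /\ `|K k| = K k.
      by split; apply/ger0_norm; rewrite /K addr_ge0// divr_ge0// mulr_ge0//; lra.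
    by rewrite Kj Kk /K; split; nra.
  have [K12 hK1 K2] := hK 1 2 ltac:(lra) ltac:(lra) ltac:(lra).
  have [K23 _ K3] := hK 2 3 ltac:(lra) ltac:(lra) ltac:(lra).
  have c3 : cvgn (pseries a (K 3)) by apply/cvg_ex; exists (f (x + K 3)); exact: af.
  have c2 : cvgn (pseries (pseries_diffs a) (K 2)) by exact: is_cvg_pseries_diffs c3 _.
  have c1 : cvgn (pseries (pseries_diffs (pseries_diffs a)) (K 1)).
    exact: is_cvg_pseries_diffs c2 _.
  split; last by apply: is_cvg_pseries_inside c2 (lt_trans hK1 K12).
  have D : is_derive h 1 (fun y => limn (pseries a y))
      (limn (pseries (pseries_diffs a) h)).
    apply: (@pseries_snd_diffs _ _ (K 1)) => //.
      exact: is_cvg_pseries_inside c3 (lt_trans K12 K23).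
    exact: is_cvg_pseries_inside c2 K12.
  have D' : is_derive (x + h) 1 (fun y => limn (pseries a (y - x)))
     (limn (pseries (pseries_diffs a) h)).
    rewrite -[X in is_derive _ _ _ X]mulr1.
    apply: (@is_derive1_comp _ (fun y => limn (pseries a y)) (fun y => y - x)).
      by rewrite addrAC subrr add0r.
    rewrite -[X in is_derive _ _ _ X]subr0; exact: is_deriveB.
  apply: near_eq_is_derive D'.
  apply/nbhs_ballP; exists (r - `|h|); first by rewrite /= subr_gt0.
  move=> y /=; rewrite /ball /= => hy.
  have yr : `|y - x| < r.
    rewrite -(subrK h (y - x)) (le_lt_trans (ler_normD _ _))// -ltrBrDr.
    by rewrite -addrA -opprD distrC.
  by have := af _ yr; rewrite (addrC x) subrK => /cvg_lim ->.
move=> fU; split=> x /fU[r [a [r0 ra]]].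
  have [+ _] := key x r a r0 ra 0 (ltac:(by rewrite normr0)).
  rewrite addr0 => D; apply: is_derive_eq (D) _.
  by rewrite derive1E; case: D.
exists r, (pseries_diffs a); split=> // h hr.
have [D cv] := key x r a r0 ra h hr.
by rewrite derive1E; case: D => _ ->.
Qed.

(** * Euclidean geometry along a line *)

Lemma dotvE (R : realType) d (x y : 'rV[R]_d) : dotv x y = (x *m y^T) 0 0.
Proof. by rewrite mxE; apply: eq_bigr => j _; rewrite mxE. Qed.

Lemma dotvC (R : realType) d (x y : 'rV[R]_d) : dotv x y = dotv y x.
Proof. by apply: eq_bigr => j _; rewrite mulrC. Qed.

Lemma dotvDl (R : realType) d (x y z : 'rV[R]_d) :
  dotv (x + y) z = dotv x z + dotv y z.
Proof. by rewrite !dotvE mulmxDl mxE. Qed.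

Lemma dotvZl (R : realType) d (a : R) (x z : 'rV[R]_d) :
  dotv (a *: x) z = a * dotv x z.
Proof. by rewrite !dotvE -scalemxAl mxE. Qed.

Lemma dotvBl (R : realType) d (x y z : 'rV[R]_d) :
  dotv (x - y) z = dotv x z - dotv y z.
Proof. by rewrite !dotvE mulmxBl !mxE. Qed.

Lemma dotvDr (R : realType) d (x y z : 'rV[R]_d) :
  dotv z (x + y) = dotv z x + dotv z y.
Proof. by rewrite dotvC dotvDl !(dotvC z). Qed.

Lemma dotvBr (R : realType) d (x y z : 'rV[R]_d) :
  dotv z (x - y) = dotv z x - dotv z y.
Proof. by rewrite dotvC dotvBl !(dotvC z). Qed.

Lemma dotvZr (R : realType) d (a : R) (x z : 'rV[R]_d) :
  dotv z (a *: x) = a * dotv z x.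
Proof. by rewrite dotvC dotvZl dotvC. Qed.

(** Subtraction comes first: [dotvDl] would also match [x - y]. *)
Definition dotv_lin := (dotvBl, dotvDl, dotvZl, dotvBr, dotvDr, dotvZr).

Lemma dotv_ge0 (R : realType) d (x : 'rV[R]_d) : 0 <= dotv x x.
Proof. by apply: sumr_ge0 => j _; rewrite -expr2 sqr_ge0. Qed.

Lemma dotv_gt0 (R : realType) d (x : 'rV[R]_d) : (0 < dotv x x) = (x != 0).
Proof.
rewrite lt0r dotv_ge0 andbT; congr (~~ _); apply/eqP/eqP => [xx0|->]; last first.
  by rewrite dotvE mul0mx mxE.
apply/rowP => j; rewrite mxE; have /eqP : x 0 j * x 0 j = 0.
  move/eqP: xx0; rewrite psumr_eq0 => [/allP/(_ j)|i _]; last by rewrite -expr2 sqr_ge0.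
  by rewrite mem_index_enum => /(_ isT) /eqP.
by rewrite mulf_eq0 orbb => /eqP.
Qed.

Definition sqdist (R : realType) d (p x : 'rV[R]_d) : R := dotv (x - p) (x - p).

(** Squared distances along a line are treated as polynomials in the parameter, so
    that their derivatives at [0] are read off as coefficients. *)
Definition sqdist_line_poly (R : realType) d (p x m : 'rV[R]_d) : {poly R} :=
  (sqdist p x)%:P + (2 * dotv (x - p) m) *: 'X + dotv m m *: 'X^2.

Lemma sqdist_line (R : realType) d (p x m : 'rV[R]_d) (tau : R) :
  sqdist p (x + tau *: m) = (sqdist_line_poly p x m).[tau].
Proof.
rewrite /sqdist_line_poly !(hornerD, hornerC, hornerZ, hornerX, hornerXn).
rewrite /sqdist addrAC; move: (x - p) => w.
by rewrite !dotv_lin (dotvC m w); ring.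
Qed.

Lemma is_derive_horner0 (R : realType) (q : {poly R}) :
  is_derive (0 : R) (1 : R) (horner q) q`_1.
Proof.
apply: is_derive_eq (is_derive_poly q 0) _.
by rewrite horner_coef0 coef_deriv mulr1n.
Qed.

Lemma is_derive_line_sqdist (R : realType) d (p x m : 'rV[R]_d)
    (g : R -> R) (dg : R) :
  is_derive (sqdist p x : R) (1 : R) g dg ->
  is_derive (0 : R) (1 : R) (fun tau => g (sqdist p (x + tau *: m)))
    (dg * (2 * dotv (x - p) m)).
Proof.
move=> Dg; set q := sqdist_line_poly p x m.
have -> : (fun tau => g (sqdist p (x + tau *: m))) = g \o horner q.
  by apply/funext => tau /=; rewrite sqdist_line.
have q1 : q`_1 = 2 * dotv (x - p) m.
  by rewrite /q /sqdist_line_poly !coefE /= mulr1 mulr0 add0r addr0.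
rewrite -q1; refine (@is_derive1_comp R g (horner q) 0 _ _ _ _).
  by rewrite -sqdist_line scale0r addr0.
exact: is_derive_horner0.
Qed.

Lemma is_derive_line_dotv (R : realType) d (p x m w : 'rV[R]_d) :
  is_derive (0 : R) (1 : R) (fun tau => dotv (x + tau *: m - p) w) (dotv m w).
Proof.
pose q := (dotv (x - p) w)%:P + dotv m w *: 'X.
have -> : (fun tau => dotv (x + tau *: m - p) w) = horner q.
  apply/funext => tau; rewrite /q !(hornerD, hornerC, hornerZ, hornerX) addrAC.
  by move: (x - p) => y; rewrite dotvDl dotvZl mulrC.
have <- : q`_1 = dotv m w by rewrite /q !coefE /= mulr1 add0r.
exact: is_derive_horner0.
Qed.

Lemma is_derive_mul_fun (R : realType) (f g : R -> R) (x df dg : R) :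
  is_derive x (1 : R) f df -> is_derive x (1 : R) g dg ->
  is_derive x (1 : R) (fun t => f t * g t) (f x * dg + g x * df).
Proof. by move=> Df Dg; exact: (@is_deriveM _ _ f g x 1 df dg). Qed.

Lemma near0_is_derive_eq0 (R : realType) (F : R -> R) (dF : R) :
  (\forall t \near (0 : R), F t = 0) -> is_derive (0 : R) (1 : R) F dF -> dF = 0.
Proof.
move=> F0 [_ <-]; rewrite (near_eq_derive (g := cst 0)).
  by rewrite derive_val.
by near=> t; rewrite /=; near: t.
Unshelve. all: by end_near. Qed.

Lemma poly_near0_eq0 (R : realType) (q : {poly R}) :
  (\forall t \near (0 : R), q.[t] = 0) -> q = 0.
Proof.
move=> /nbhs_ballP[e /= e0 qe].
pose s := [seq e / k.+2%:R | k <- iota 0 (size q)].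
apply: (@roots_geq_poly_eq0 _ q s).
- apply/allP => _ /mapP[k _ ->]; apply/rootP/qe.
  rewrite /ball /= sub0r normrN gtr0_norm ?divr_gt0//.
  by rewrite ltr_pdivrMr// ltr_pMr// ltr1n.
- rewrite map_inj_uniq ?iota_uniq// => i j.
  move=> /(mulfI (lt0r_neq0 e0)) /invr_inj /eqP.
  by rewrite eqr_nat !eqSS => /eqP.
- by rewrite size_map size_iota.
Qed.

(** * Additive relations between squared distances *)

(** The rational function [num / den] and its total derivatives when [u] and [v]
    move with velocities [du] and [dv]; the scalars [a], [b] and [c] are the inner
    products of the gradients [n1] and [n2] of [u] and [v].  They are defined
    over any commutative ring because they are evaluated both at real numbers
    and at polynomials in the parameter of a line. *)
Section LogDerivative.
Variables (S : comNzRingType) (a b c : S).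

Definition num (u v : S) :=
  a * v * (v - 1) - b * u * v - b * u * (v - 1) + c * u * u.

Definition den (u v : S) := 2 * u * v * (1 - u - v).

Definition dnum (u v du dv : S) :=
  (2 * a * v - a - 2 * b * u) * dv + (2 * c * u - b * v - b * (v - 1)) * du.

Definition dden (u v du dv : S) :=
  2 * (du * v * (1 - u - v) + u * dv * (1 - u - v) - u * v * (du + dv)).

(** The velocities of [u] and [v] in the direction [v n1 - (u - 1) n2], which is
    tangent to the spheres around the centre belonging to [u]. *)
Definition rot_u (u v : S) := a * v - b * (u - 1).
Definition rot_v (u v : S) := b * v - c * (u - 1).

(** The numerator, up to sign, of the derivative of [num / den] in that
    direction. *)
Definition rot_wronskian (u v : S) :=
  dden u v (rot_u u v) (rot_v u v) * num u v
  - den u v * dnum u v (rot_u u v) (rot_v u v).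

End LogDerivative.

Lemma is_derive_den (R : realType) (f h : R -> R) (df dh : R) :
  is_derive (0 : R) (1 : R) f df -> is_derive (0 : R) (1 : R) h dh ->
  is_derive (0 : R) (1 : R) (fun s => den (f s) (h s)) (dden (f 0) (h 0) df dh).
Proof.
move=> Df Dh.
have Dc k : is_derive (0 : R) (1 : R) (fun=> k : R) 0 by exact: is_derive_cst.
have D := is_derive_mul_fun
  (is_derive_mul_fun (is_derive_mul_fun (Dc 2) Df) Dh)
  (is_deriveB (is_deriveB (Dc 1) Df) Dh).
by apply: is_derive_eq (D) _; rewrite /dden !fctE; ring.
Qed.

Lemma is_derive_num (R : realType) (a b c : R) (f h : R -> R) (df dh : R) :
  is_derive (0 : R) (1 : R) f df -> is_derive (0 : R) (1 : R) h dh ->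
  is_derive (0 : R) (1 : R) (fun s => num a b c (f s) (h s))
    (dnum a b c (f 0) (h 0) df dh).
Proof.
move=> Df Dh.
have Dc k : is_derive (0 : R) (1 : R) (fun=> k : R) 0 by exact: is_derive_cst.
have D1 := is_derive_mul_fun (is_derive_mul_fun (Dc a) Dh)
  (is_deriveB Dh (Dc 1)).
have D2 := is_derive_mul_fun (is_derive_mul_fun (Dc b) Df) Dh.
have D3 := is_derive_mul_fun (is_derive_mul_fun (Dc b) Df)
  (is_deriveB Dh (Dc 1)).
have D4 := is_derive_mul_fun (is_derive_mul_fun (Dc c) Df) Df.
have D := is_deriveD (is_deriveB (is_deriveB D1 D2) D3) D4.
by apply: is_derive_eq (D) _; rewrite /dnum !fctE; ring.
Qed.

(** [n1] and [n2] are the gradients of the barycentric coordinates [u] and [v]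
    belonging to [p i1] and [p i2]. *)
Section NoAdditiveRelation.
Variables (R : realType) (d n : nat) (p : 'I_n -> 'rV[R]_d).
Variables (U : 'I_n -> set R) (phi : 'I_n -> R -> R).
Variables (i0 i1 i2 : 'I_n) (n1 n2 : 'rV[R]_d).
Hypothesis i12 : i1 != i2.
Hypothesis n1P : forall i, dotv (p i - p i0) n1 = (i == i1)%:R.
Hypothesis n2P : forall i, dotv (p i - p i0) n2 = (i == i2)%:R.
Hypothesis U_open : forall i, open (U i).

Let O : set 'rV[R]_d := [set x | forall i, U i (sqdist (p i) x)].

Lemma line_near x m : O x -> \forall t \near (0 : R), O (x + t *: m).
Proof.
move=> Ox.
have H i : \forall t \near (0 : R), U i (sqdist (p i) (x + t *: m)).
  pose q := sqdist_line_poly (p i) x m.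
  have C : horner q @ (0 : R) --> q.[0] by exact: continuous_horner.
  have Ui : nbhs q.[0] (U i).
    rewrite -sqdist_line scale0r addr0; apply: open_nbhs_nbhs.
    by split => //; exact: Ox.
  have Cn : nbhs (0 : R) [set t | U i q.[t]] := C _ Ui.
  by apply: filterS Cn => t /=; rewrite sqdist_line.
exact: filter_forall H.
Qed.

Hypothesis phi_an : forall i, analytic_on (U i) (phi i).
Hypothesis dphi1 : forall s, U i1 s -> derive1 (phi i1) s != 0.
Hypothesis sum0 : forall x, O x -> \sum_i phi i (sqdist (p i) x) = 0.

Let g i := derive1 (phi i).
Let t i x := sqdist (p i) x.
Let u x := dotv (x - p i0) n1.
Let v x := dotv (x - p i0) n2.
Let a := dotv n1 n1.
Let b := dotv n1 n2.
Let c := dotv n2 n2.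

Lemma bary_shift i x : (dotv (x - p i) n1 = u x - (i == i1)%:R) *
  (dotv (x - p i) n2 = v x - (i == i2)%:R).
Proof. by rewrite -n1P -n2P /u /v -!dotvBl !opprB !addrA !subrK. Qed.

Lemma dot_n12 : (dotv n1 n1 = a) * (dotv n1 n2 = b) *
  (dotv n2 n1 = b) * (dotv n2 n2 = c).
Proof. by rewrite [dotv n2 n1]dotvC. Qed.

Lemma is_derive_g i s :
  U i s -> is_derive (s : R) (1 : R) (g i) (derive1 (g i) s).
Proof.
have [_ /analytic_on_derive[H _]] := analytic_on_derive (@phi_an i).
exact: H.
Qed.

Lemma is_derive_dg i s : U i s ->
  is_derive (s : R) (1 : R) (derive1 (g i)) (derive1 (derive1 (g i)) s).
Proof.
have [_ /analytic_on_derive[_ /analytic_on_derive[H _]]] :=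
  analytic_on_derive (@phi_an i).
exact: H.
Qed.

Lemma gradient_eq0 x m : O x -> \sum_i g i (t i x) * dotv (x - p i) m = 0.
Proof.
move=> Ox.
have D i : is_derive (0 : R) (1 : R) (fun s => phi i (t i (x + s *: m)))
    (g i (t i x) * (2 * dotv (x - p i) m)).
  apply: is_derive_line_sqdist.
  have [H _] := analytic_on_derive (@phi_an i).
  by apply: H; exact: Ox.
have F0 : \forall s \near (0 : R),
    (\sum_i (fun s => phi i (t i (x + s *: m)))) s = 0.
  by apply: filterS (line_near m Ox) => s Os; rewrite fct_sumE sum0.
have := near0_is_derive_eq0 F0 (is_derive_sum D).
under eq_bigr do rewrite mulrCA; rewrite -mulr_sumr => /eqP.
by rewrite mulf_eq0 pnatr_eq0 /= => /eqP.
Qed.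

(** Pairing the gradient with [n1] and [n2] gives [g i1 = S * u] and
    [g i2 = S * v] for the same factor [S], the sum of all the [g i]. *)
Lemma bary_proportional x : O x -> u x * g i2 (t i2 x) = v x * g i1 (t i1 x).
Proof.
move=> Ox; pose S := \sum_i g i (t i x).
have E (m : 'rV[R]_d) (j : 'I_n) (w : R) :
    (forall i, dotv (x - p i) m = w - (i == j)%:R) -> S * w = g j (t j x).
  move=> wP; apply/eqP; rewrite -subr_eq0; apply/eqP.
  rewrite -[RHS](gradient_eq0 m Ox) mulr_suml.
  have -> : g j (t j x) = \sum_i g i (t i x) * (i == j)%:R.
    rewrite (bigD1 j)//= eqxx mulr1 big1 ?addr0// => i /negbTE ->.
    by rewrite mulr0.
  by rewrite -sumrB; apply: eq_bigr => i _; rewrite wP mulrBr.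
have Eu := E n1 i1 (u x) (fun i => (bary_shift i x).1).
have Ev := E n2 i2 (v x) (fun i => (bary_shift i x).2).
by rewrite -Eu -Ev; ring.
Qed.

(** Along the direction [m], tangent to the sphere around [p i2], the factor
    [g i2] is constant to first order, so differentiating [bary_proportional]
    brings in the derivative of [g i1] only.  The factor [g i2] itself is then
    eliminated by [bary_proportional]. *)
Lemma log_derivative_rational x : O x ->
  den (u x) (v x) * derive1 (g i1) (t i1 x)
  = num a b c (u x) (v x) * g i1 (t i1 x).
Proof.
move=> Ox; have uv := bary_proportional Ox.
pose m := (v x - 1) *: n1 - u x *: n2.
have D1 := is_derive_line_sqdist m (is_derive_g (Ox i1)).
have D2 := is_derive_line_sqdist m (is_derive_g (Ox i2)).
have Du := is_derive_line_dotv (p i0) x m n1.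
have Dv := is_derive_line_dotv (p i0) x m n2.
have D := is_deriveB (is_derive_mul_fun Du D2) (is_derive_mul_fun Dv D1).
have F0 : \forall s \near (0 : R),
    ((fun s => u (x + s *: m) * g i2 (t i2 (x + s *: m)))
     - (fun s => v (x + s *: m) * g i1 (t i1 (x + s *: m)))) s = 0.
  apply: filterS (line_near m Ox) => s /bary_proportional E.
  by rewrite fctE E subrr.
have := near0_is_derive_eq0 F0 D.
rewrite scale0r addr0 -/(u x) -/(v x) -/(t i1 x) -/(t i2 x).
have mw w : dotv w m = (v x - 1) * dotv w n1 - u x * dotv w n2.
  by rewrite dotvBr !dotvZr.
rewrite {D D1 D2 Du Dv F0} !(dotvC m) !mw !bary_shift !dot_n12.
rewrite !eqxx (negbTE i12) eq_sym (negbTE i12) /num /den.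
move: uv; set g1 := g i1 _; set g2 := g i2 _.
set d2 := derive1 _ _; set d1 := derive1 _ _.
move: (u x) (v x) => X Y uv E.
(* Multiplying by [X] turns [X * g2] into [Y * g1]. *)
have H1 := congr1 (fun z => X * z) E.
have H2 := congr1 (fun z => ((Y - 1) * a - X * b) * z) uv.
by rewrite /= in H1 H2; lra.
Qed.

(** Along the direction [m], tangent to the sphere around [p i1], both [g i1]
    and its derivative are constant, so differentiating
    [log_derivative_rational] gives a second linear equation between them; the
    two equations are compatible with [g i1 != 0] only if their determinant
    vanishes. *)
Lemma rot_wronskian_eq0 x : O x -> rot_wronskian a b c (u x) (v x) = 0.
Proof.
move=> Ox.
pose m := v x *: n1 - (u x - 1) *: n2.
have mw w : dotv w m = v x * dotv w n1 - (u x - 1) * dotv w n2.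
  by rewrite dotvBr !dotvZr.
have tm0 : dotv (x - p i1) m = 0.
  rewrite mw !bary_shift eqxx (negbTE i12) mulr1n mulr0n subr0.
  by rewrite mulrC subrr.
have level (h : R -> R) (dh : R) : is_derive (t i1 x : R) (1 : R) h dh ->
    is_derive (0 : R) (1 : R) (fun s => h (t i1 (x + s *: m))) 0.
  by move=> Dh; have := is_derive_line_sqdist m Dh; rewrite tm0 !mulr0.
have D1 := level _ _ (is_derive_g (Ox i1)).
have D2 := level _ _ (is_derive_dg (Ox i1)).
have Du := is_derive_line_dotv (p i0) x m n1.
have Dv := is_derive_line_dotv (p i0) x m n2.
have D := is_deriveB (is_derive_mul_fun (is_derive_den Du Dv) D2)
  (is_derive_mul_fun (is_derive_num a b c Du Dv) D1).
have F0 : \forall s \near (0 : R),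
    ((fun s => den (u (x + s *: m)) (v (x + s *: m))
               * derive1 (g i1) (t i1 (x + s *: m)))
     - (fun s => num a b c (u (x + s *: m)) (v (x + s *: m))
                 * g i1 (t i1 (x + s *: m)))) s = 0.
  apply: filterS (line_near m Ox) => s /log_derivative_rational.
  by rewrite fctE => ->; rewrite subrr.
have := near0_is_derive_eq0 F0 D.
rewrite scale0r addr0 -/(u x) -/(v x) -/(t i1 x) {D D1 D2 Du Dv F0}.
rewrite !mulr0 !add0r !(dotvC m) !mw !dot_n12.
have -> : v x * a - (u x - 1) * b = rot_u a b (u x) (v x).
  by rewrite /rot_u; ring.
have -> : v x * b - (u x - 1) * c = rot_v b c (u x) (v x).
  by rewrite /rot_v; ring.
have := log_derivative_rational Ox.
have := @dphi1 _ (Ox i1); rewrite -/(g i1) -/(t i1 x) /rot_wronskian.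
set g1 := g i1 _; set g1' := derive1 _ _.
move: (dden _ _ _ _) (dnum _ _ _ _ _ _ _) => den' num'.
move: (den _ _) (num _ _ _ _ _) => den0 num0 g10 E1 E2.
apply/eqP; rewrite -(mulIr_eq0 _ (mulIf g10)); apply/eqP.
transitivity (den' * (num0 * g1) - den0 * (num' * g1)); first by ring.
by rewrite -E1; have H2 := congr1 (fun z => den0 * z) E2; rewrite /= in H2; lra.
Qed.

(** On any line through [x0] the polynomial [rot_wronskian a b c] in [u] and [v]
    vanishes near [x0], hence everywhere, and such a line reaches any given
    values of [u] and [v].  At [v = 0] it equals
    [2 u (u - 1)^2 c * u (b + c u)], which cannot vanish at both [u = 2] and
    [u = 3]. *)
Lemma no_additive_relation x0 : ~ O x0.
Proof.
move=> Ox; have c_gt0 : 0 < c.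
  rewrite dotv_gt0; apply/eqP => n20; have := n2P i2.
  by rewrite n20 dotvE trmx0 mulmx0 mxE eqxx => /eqP; rewrite eq_sym oner_eq0.
have W0 (u1 v1 : R) : rot_wronskian a b c u1 v1 = 0.
  (* [p i1 - p i0] moves [u] but not [v], and [p i2 - p i0] moves [v] but not
     [u]. *)
  pose m := (u1 - u x0) *: (p i1 - p i0) + (v1 - v x0) *: (p i2 - p i0).
  have mn1 : dotv m n1 = u1 - u x0.
    by rewrite dotvDl !dotvZl !n1P eqxx eq_sym (negbTE i12) mulr1 mulr0 addr0.
  have mn2 : dotv m n2 = v1 - v x0.
    by rewrite dotvDl !dotvZl !n2P eqxx (negbTE i12) mulr1 mulr0 add0r.
  pose qu := (u x0)%:P + (u1 - u x0) *: 'X.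
  pose qv := (v x0)%:P + (v1 - v x0) *: 'X.
  pose q := rot_wronskian a%:P b%:P c%:P qu qv.
  have quE s : qu.[s] = u x0 + (u1 - u x0) * s.
    by rewrite hornerD hornerC hornerZ hornerX.
  have qvE s : qv.[s] = v x0 + (v1 - v x0) * s.
    by rewrite hornerD hornerC hornerZ hornerX.
  have qE s : q.[s] = rot_wronskian a b c qu.[s] qv.[s].
    have one : (1 : {poly R}).[s] = 1 := hornerC _ _.
    have two : (2 : {poly R}).[s] = 2 by rewrite hornerMn one.
    rewrite /q /rot_wronskian /dden /dnum /den /num /rot_u /rot_v.
    by move: qu qv {quE qvE q} => qu qv;
      rewrite !(hornerD, hornerN, hornerM, hornerC, one, two).
  have q0 : q = 0.
    apply: poly_near0_eq0.
    apply: filterS (line_near m Ox) => s /rot_wronskian_eq0; rewrite qE.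
    have -> : u (x0 + s *: m) = u x0 + (u1 - u x0) * s.
      by rewrite /u addrAC dotvDl dotvZl mn1 mulrC.
    have -> : v (x0 + s *: m) = v x0 + (v1 - v x0) * s.
      by rewrite /v addrAC dotvDl dotvZl mn2 mulrC.
    by rewrite quE qvE.
  by have := qE 1; rewrite q0 horner0 quE qvE !mulr1 ![_ + (_ - _)]addrC !subrK.
have := W0 2 0; have := W0 3 0.
rewrite /rot_wronskian /dden /dnum /den /num /rot_u /rot_v => W3 W2.
by have := mulr_gt0 c_gt0 c_gt0; lra.
Qed.

End NoAdditiveRelation.

(** * The quadric of squared distances *)

Lemma bianalytic_derive_neq0 (R : realType) (U W : set R) (phi : R -> R) :
  open U -> bianalytic U W phi -> forall s, U s -> derive1 phi s != 0.
Proof.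
move=> oU [[phiW _ _] /analytic_on_derive[Dphi _]].
move=> [psi [psiK /analytic_on_derive[Dpsi _]]] s Us.
have D := @is_derive1_comp R psi phi s _ _ (Dpsi _ (phiW _ Us)) (Dphi _ Us).
have D1 : is_derive s (1 : R) (id : R -> R) (derive1 psi (phi s) * derive1 phi s).
  apply: near_eq_is_derive D.
  have Us' : nbhs s U by apply: open_nbhs_nbhs.
  by apply: filterS Us' => y /psiK.
apply/eqP => phi0; case: D1 => _; rewrite derive_id phi0 mulr0 => /eqP.
by rewrite oner_eq0.
Qed.

Section Distances.
Variables (R : realType) (d : nat) (p : 'I_d.+1 -> 'rV[R]_d).

Definition edge_mx : 'M[R]_d := \matrix_j (p (lift ord0 j) - p ord0).

Definition sqdists (x : 'rV[R]_d) : 'rV[R]_d.+1 := \row_i sqdist (p i) x.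

(** With [w = x - p ord0] and [e] an edge at [p ord0], this is
    [w . e = (|w|^2 - |w - e|^2 + |e|^2) / 2]. *)
Definition polarization (t : 'rV[R]_d.+1) : 'rV[R]_d :=
  \row_j ((t 0 ord0 - t 0 (lift ord0 j) + dotv (row j edge_mx) (row j edge_mx)) / 2).

Definition locate (t : 'rV[R]_d.+1) : 'rV[R]_d :=
  p ord0 + polarization t *m invmx edge_mx^T.

Hypothesis edge_unit : edge_mx \in unitmx.

Lemma edgeT_unit : edge_mx^T \in unitmx. Proof. by rewrite unitmx_tr. Qed.

Lemma row_edge j : row j edge_mx = p (lift ord0 j) - p ord0.
Proof. by rewrite rowK. Qed.

Lemma dotv_edge w j : dotv w (row j edge_mx) = (w *m edge_mx^T) 0 j.
Proof. by rewrite /dotv mxE; apply: eq_bigr => k _; rewrite !mxE. Qed.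

Lemma sqdist_lift x j : sqdist (p (lift ord0 j)) x =
  sqdist (p ord0) x - 2 * dotv (x - p ord0) (row j edge_mx)
  + dotv (row j edge_mx) (row j edge_mx).
Proof.
have -> : sqdist (p (lift ord0 j)) x =
    dotv (x - p ord0 - row j edge_mx) (x - p ord0 - row j edge_mx).
  by rewrite row_edge opprB addrA subrK.
rewrite /sqdist; move: (x - p ord0) (row j _) => w e.
by rewrite !dotv_lin (dotvC e w); ring.
Qed.

Lemma locateB t : locate t - p ord0 = polarization t *m invmx edge_mx^T.
Proof. by rewrite /locate addrC addKr. Qed.

Lemma sqdistsK x : locate (sqdists x) = x.
Proof.
rewrite /locate (_ : polarization _ = (x - p ord0) *m edge_mx^T).
  by rewrite mulmxK ?edgeT_unit// addrC subrK.
apply/rowP => j; rewrite -dotv_edge !mxE sqdist_lift.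
by field.
Qed.

Definition relation : set 'rV[R]_d.+1 :=
  [set t | sqdist (p ord0) (locate t) = t 0 ord0].

Lemma relationP t : relation t <-> sqdists (locate t) = t.
Proof.
split=> [tQ|<-]; last by rewrite /relation /= sqdistsK mxE.
apply/rowP => i; rewrite mxE; case: (unliftP ord0 i) => [j|] -> //.
rewrite sqdist_lift tQ locateB dotv_edge mulmxKV ?edgeT_unit//.
by rewrite mxE; field.
Qed.

Lemma relation_sqdists x : relation (sqdists x).
Proof. by apply/relationP; rewrite sqdistsK. Qed.

Definition relation_poly : mpoly.mpoly d.+1 R :=
  \sum_(k < d) (\sum_(j < d) mpolyC _ ((invmx edge_mx^T) j k / 2) *
     (mpolyX _ (mnm1 ord0) - mpolyX _ (mnm1 (lift ord0 j))
      + mpolyC _ (dotv (row j edge_mx) (row j edge_mx)))) ^+ 2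
  - mpolyX _ (mnm1 ord0).

Lemma relation_polyE (t : 'rV[R]_d.+1) :
  meval (fun i => t 0 i) relation_poly = sqdist (p ord0) (locate t) - t 0 ord0.
Proof.
rewrite /relation_poly rmorphB /= mevalXU rmorph_sum /=; congr (_ - _).
rewrite /sqdist locateB; apply: eq_bigr => k _.
rewrite rmorphXn /= expr2 rmorph_sum /= mxE; congr (_ * _);
  apply: eq_bigr => j _; rewrite rmorphM rmorphD rmorphB /= !mevalC !mevalXU;
  by rewrite mxE; ring.
Qed.

Lemma relation_semialgebraic :
  semialgebraic (maxn 1 (msize relation_poly)) relation.
Proof.
exists 1%N, (fun=> PolyEq0 relation_poly),
  (fun b : {ffun 'I_1 -> bool} => b ord0).
split; first by rewrite leq_maxl.
  by move=> i /=; rewrite leqW// leq_maxr.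
apply/seteqP; split=> t; rewrite /relation /= ffunE /= relation_polyE subr_eq0.
  by move=> ->.
by move/eqP.
Qed.

(** Changing one coordinate of [t] by [s] moves [locate t] by [s *: m] for a
    fixed nonzero [m], so on a fibre the equation of the quadric is quadratic in
    [s] with leading coefficient [dotv m m]. *)
Lemma relation_finite_to_one : (0 < d)%N -> finite_to_one_projections relation.
Proof.
move=> d0 i y; set A := _ `&` _.
have [[t [tQ ty]]|A0] := pselect (A !=set0); last first.
  by rewrite (_ : A = set0)//; apply/seteqP; split=> // t At; apply: A0; exists t.
pose dl : 'rV[R]_d.+1 := delta_mx 0 i.
pose h : 'rV[R]_d := \row_j ((dl 0 ord0 - dl 0 (lift ord0 j)) / 2).
pose m := h *m invmx edge_mx^T.
have h0 : h != 0.
  apply/eqP => /rowP h0.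
  case: (unliftP ord0 i) => [j ij|i0].
    have := h0 j; rewrite !mxE ij !eqxx /= => /eqP.
    by rewrite sub0r mulf_eq0 oppr_eq0 oner_eq0 invr_eq0 pnatr_eq0.
  have := h0 (Ordinal d0); rewrite !mxE i0 /= => /eqP.
  by rewrite subr0 mulf_eq0 oner_eq0 invr_eq0 pnatr_eq0.
have m0 : 0 < dotv m m.
  rewrite dotv_gt0; apply: contraNneq h0 => m0.
  by rewrite -(mulmxKV edgeT_unit h) -/m m0 mul0mx.
have locateD s : locate (t + s *: dl) = locate t + s *: m.
  rewrite /locate -addrA; congr (_ + _); rewrite /m scalemxAl -mulmxDl.
  congr (_ *m _).
  by apply/rowP => j; rewrite !mxE; ring.
(* The root other than [s = 0], which is the point [t] itself. *)
pose s1 := (dl 0 ord0 - 2 * dotv (locate t - p ord0) m) / dotv m m.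
apply: (@sub_finite_set _ _ [set t; t + s1 *: dl]); last exact: finite_set2.
move=> t' [t'Q t'y].
have E : t' = t + (t' 0 i - t 0 i) *: dl.
  apply/rowP => k; rewrite !mxE eqxx /=; case: (unliftP i k) => [k' ->|->].
    rewrite eq_sym (negbTE (neq_lift _ _)) mulr0 addr0.
    by have /rowP/(_ k') := etrans t'y (esym ty); rewrite !mxE.
  by rewrite eqxx mulr1 addrC subrK.
move: E t'Q; set s := _ - _ => -> {t'y}.
rewrite /relation /= locateD sqdist_line.
rewrite /sqdist_line_poly !(hornerD, hornerC, hornerZ, hornerX, hornerXn) tQ.
have -> : (t + s *: dl) 0 ord0 = t 0 ord0 + s * dl 0 ord0 by rewrite !mxE.
move=> Es.
have [->|s0] := eqVneq s 0; [left|right].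
  by rewrite scale0r addr0.
congr (_ + _ *: _); rewrite /s1; move: m0 Es; set e := dl 0 ord0.
move: (dotv _ m) (dotv m m) => D C C0 Es.
apply: (mulIf (lt0r_neq0 C0)); rewrite divfK ?lt0r_neq0//.
by apply: (mulIf s0); lra.
Qed.

(** A group form holds near some point of the quadric because [0] is in the
    common range [W] of the [phi i]; pulled back by [sqdists], it is an additive
    relation on an open set of [x].  The gradients of the barycentric
    coordinates are the columns of the inverse of the edge matrix. *)
Lemma relation_not_group_form : (1 < d)%N -> ~ group_form relation.
Proof.
move=> d1 [U [W [phi [oU [oW W0] bi rel]]]].
have /choice[s sP] i : exists x, U i x /\ phi i x = 0.
  by have [[_ _ surj] _ _] := bi i; have [x Ux xE] := surj _ W0; exists x.
pose t : 'rV[R]_d.+1 := \row_i s i.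
have tU i : U i (t 0 i) by rewrite mxE; case: (sP i).
have tQ : relation t.
  by apply/rel => //; rewrite big1// => i _; rewrite mxE; case: (sP i).
pose j1 : 'I_d := Ordinal (ltnW d1); pose j2 : 'I_d := Ordinal d1.
pose n j : 'rV[R]_d := (col j (invmx edge_mx))^T.
have nP j i : dotv (p i - p ord0) (n j) = (i == lift ord0 j)%:R.
  case: (unliftP ord0 i) => [k ->|->]; last by rewrite subrr dotvE mul0mx mxE.
  rewrite -row_edge dotvE trmxK colE mulmxA -row_mul mulmxV// -row_mul mul1mx.
  rewrite !mxE eqxx andbT.
  by rewrite (inj_eq (@lift_inj _ _)).
have oUi i : open (U i) by case: (oU i).
apply: (@no_additive_relation R d d.+1 p U phi ord0 (lift ord0 j1) (lift ord0 j2)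
  (n j1) (n j2) _ (nP j1) (nP j2) oUi _ _ _ (locate t)).
- by rewrite (inj_eq (@lift_inj _ _)).
- by move=> i; case: (bi i).
- exact: bianalytic_derive_neq0 (oUi _) (bi _).
- move=> x Ox.
  have xU i : U i (sqdists x 0 i) by rewrite mxE; exact: Ox.
  have := (rel (sqdists x) xU).1 (relation_sqdists x).
  by under eq_bigr do rewrite mxE.
- move=> i; have /relationP tE := tQ.
  have -> : sqdist (p i) (locate t) = t 0 i by rewrite -[in RHS]tE mxE.
  exact: tU.
Qed.

End Distances.

(** * Counting points and the degenerate case *)

Lemma is_hypersphereE (R : realType) d (q : 'rV[R]_d) (H : set 'rV[R]_d) :
  is_hypersphere q H -> exists s, H = [set x | sqdist q x = s].
Proof.
move=> [r [r0 ->]]; exists (r ^+ 2); apply/seteqP; split=> x /=;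
  rewrite /eucl_norm -/(sqdist q x).
  by move=> <-; rewrite sqr_sqrtr// dotv_ge0.
by move=> ->; rewrite sqrtr_sqr gtr0_norm.
Qed.

Lemma finite_box (R : realType) (s : nat) (A : 'I_s -> {fset R}) :
  finite_set [set x : 'rV[R]_s | forall i, x 0 i \in A i].
Proof.
pose B := (\bigcup_(i in 'I_s) A i)%fset.
apply: (@sub_finite_set _ _
  ((fun f : {ffun 'I_s -> B} => \row_i val (f i)) @` setT)).
  move=> x xA; have xB i : x 0 i \in B.
    by apply/bigfcupP; exists i => //; rewrite mem_index_enum.
  by exists [ffun i => [` xB i]%fset] => //; apply/rowP => i; rewrite mxE ffunE.
exact/finite_image/finite_finset.
Qed.

Section Count.
Variables (R : realType) (d : nat) (p : 'I_d.+1 -> 'rV[R]_d).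
Hypothesis edge_unit : edge_mx p \in unitmx.

(** A sphere of the family [S i] is determined by its squared radius [f (i, H)],
    so the sets [A i] of squared radii have size [n], and the map [sqdists]
    sends the points counted injectively into the quadric and the grid. *)
Lemma count_le (eta0 c : R) (n : nat) (S : 'I_d.+1 -> {fset (set 'rV[R]_d)})
    (P : {fset 'rV[R]_d}) :
  power_saving eta0 c (relation p) ->
  (forall i, #|` S i| = n) ->
  (forall i H, H \in S i -> is_hypersphere (p i) H) ->
  (forall q, q \in P -> forall i, exists H, H \in S i /\ H q) ->
  #|` P|%:R <= c * n%:R `^ (d%:R - eta0).
Proof.
move=> save Sn Ssph PS.
have /choice[f fP] (iH : 'I_d.+1 * set 'rV[R]_d) : exists s,
    is_hypersphere (p iH.1) iH.2 -> iH.2 = [set x | sqdist (p iH.1) x = s].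
  have [/is_hypersphereE[s sE]|nH] := pselect (is_hypersphere (p iH.1) iH.2).
    by exists s.
  by exists 0.
pose A i : {fset R} := [fset f (i, H) | H in S i]%fset.
have An i : #|` A i| = n.
  rewrite card_in_imfset ?Sn//= => H H' /Ssph/(fP (i, H)) /= HE.
  by move=> /Ssph/(fP (i, H')) /= H'E E; rewrite HE H'E E.
have := save n A An; rewrite (_ : d.+1%:R - 1 - eta0 = d%:R - eta0); last first.
  by rewrite -natr1; ring.
apply: le_trans; rewrite ler_nat.
have <- : #|` [fset sqdists p q | q in P]%fset| = #|` P|.
  by rewrite card_imfset//; exact: can_inj (sqdistsK edge_unit).
apply: fsubset_leq_card; apply/fsubsetP => _ /imfsetP[/= q qP ->].
rewrite in_fset_set; last by apply: finite_setIr; exact: finite_box.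
rewrite inE; split; first exact: relation_sqdists.
move=> i; rewrite mxE; have [H [HS Hq]] := PS q qP i.
apply/imfsetP; exists H => //=; have /= HE := fP (i, H) (Ssph _ _ HS).
by move: Hq; rewrite {1}HE.
Qed.

End Count.

Lemma powR_dominates (R : realType) (C c e eta : R) : 0 < C -> 0 < eta ->
  exists N : nat, forall n, (N <= n)%N -> c * n%:R `^ (e - eta) < C * n%:R `^ e.
Proof.
move=> C0 eta0.
have K0 : 0 <= `|c| / C by rewrite divr_ge0// ltW.
exists (Num.Def.archi_bound ((`|c| / C) `^ eta^-1)) => n Nn.
have nK : (`|c| / C) `^ eta^-1 < n%:R.
  by apply: lt_le_trans (archi_boundP (powR_ge0 _ _)) _; rewrite ler_nat.
have n0 : 0 < n%:R :> R := le_lt_trans (powR_ge0 _ _) nK.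
have Kn : `|c| / C < n%:R `^ eta.
  have := gt0_ltr_powR eta0 _ _ nK; rewrite !nnegrE powR_ge0 ler0n.
  by rewrite -powRrM mulVf ?lt0r_neq0// powRr1//; apply.
have en : n%:R `^ e = n%:R `^ (e - eta) * n%:R `^ eta :> R.
  by rewrite -powRD ?subrK// (lt0r_neq0 n0) implybT.
rewrite en mulrCA mulrC ltr_pM2l ?powR_gt0//.
by rewrite (le_lt_trans (ler_norm c))// -ltr_pdivrMl// mulrC.
Qed.

(** A vector in the left kernel of the edge matrix is an affine dependency, and
    one in the right kernel is normal to a hyperplane through all the points. *)
Lemma singular_edges (R : realType) d (p : 'I_d.+1 -> 'rV[R]_d) :
  edge_mx p \notin unitmx -> affinely_dependent p /\ in_common_hyperplane p.
Proof.
rewrite unitmxE unitfE negbK => E0; split.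
  have /det0P[v v0 vE] := E0.
  pose a i := if unlift ord0 i is Some j then v 0 j else - \sum_j v 0 j.
  have a0 : a ord0 = - \sum_j v 0 j by rewrite /a unlift_none.
  have aS j : a (lift ord0 j) = v 0 j by rewrite /a liftK.
  exists a; split.
  - move: v0; rewrite -[v != 0]negbK; case: eqP => // v0 _.
    apply/not_existsP => av; apply: v0; apply/rowP => j; rewrite mxE -aS.
    by apply/eqP/negPn/negP/av.
  - by rewrite big_ord_recl a0 (eq_bigr (v 0) (fun j _ => aS j)) addNr.
  - rewrite big_ord_recl a0 (eq_bigr (fun j => v 0 j *: p (lift ord0 j))); last first.
      by move=> j _; rewrite aS.
    transitivity (\sum_j v 0 j *: row j (edge_mx p)); last first.
      by rewrite -mulmx_sum_row.
    rewrite scaleNr scaler_suml addrC -sumrB.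
    by apply: eq_bigr => j _; rewrite row_edge scalerBr.
have /det0P[w w0 wE] : \det (edge_mx p)^T == 0 by rewrite det_tr.
exists w, (dotv w (p ord0)); split=> // i; case: (unliftP ord0 i) => [j|] -> //.
by apply/eqP; rewrite -subr_eq0 -dotvBr -row_edge dotv_edge wE mxE.
Qed.

Theorem theorem2p9 (R : realType) (d : nat) (hd : (2 <= d)%N)
    (p : 'I_d.+1 -> 'rV[R]_d) (eta0 eta : R)
    (heta0 : elekes_szabo_exponent d.+1 eta0) (heta : eta = eta0 / 2)
    (hmany : exists C : R, 0 < C /\
       forall N : nat, exists n : nat, (N <= n)%N /\
         exists S : 'I_d.+1 -> {fset (set 'rV[R]_d)},
           [/\ forall i, #|` S i| = n,
               forall i H, H \in S i -> is_hypersphere (p i) H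
             & exists P : {fset 'rV[R]_d},
                 (forall q, q \in P ->
                    forall i, exists H, H \in S i /\ H q) /\
                 C * n%:R `^ (d%:R - eta) <= #|` P|%:R]) :
  affinely_dependent p /\ in_common_hyperplane p.
Proof.
have [edge_unit|] := boolP (edge_mx p \in unitmx); last exact: singular_edges.
exfalso; have [_ eta0_gt0 dich] := heta0.
(* The complexity bound may depend on [p], because [relation p] does not depend
   on [n]. *)
have [c [_ /(_ (relation p))]] := dich (maxn 1 (msize (relation_poly p))).
case=> [||[save _]|[_ grp]].
- exact: relation_semialgebraic.
- by apply: relation_finite_to_one => //; exact: leq_trans hd.
- have [C [C0 many]] := hmany.
  have eta_gt0 : 0 < eta by rewrite heta divr_gt0.
  have [N NP] := powR_dominates c (d%:R - eta) C0 eta_gt0.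
  have [n [Nn [S [Sn Ssph [P [PS CP]]]]]] := many N.
  have etaE : d%:R - eta0 = d%:R - eta - eta by rewrite heta; field.
  have := count_le edge_unit save Sn Ssph PS; rewrite etaE => Pc.
  by have := le_lt_trans (le_trans CP Pc) (NP n Nn); rewrite ltxx.
- exact: (relation_not_group_form edge_unit hd grp).
Qed.
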